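(* Consider the system $$\dot x = Ax+Bu+Ev,\qquad \dot v = Sv,\qquad e = Cx+Fv,$$ with state $x\in\mathbb{R}^{n_x}$, input $u\in\mathbb{R}^{n_u}$, exosignal $v=\mathrm{col}(r,w)\in\mathbb{R}^{n_v}$ and tracking error $e\in\mathbb{R}^{n_y}$, where $E=[0\ \ E_w]$, $F=[-I\ \ F_w]$, $S=\mathrm{blockdiag}(S_r,S_w)$, and $A,B,C,E_w,F_w$ are fixed (unknown) real matrices. Assume that $S$ (known) has no eigenvalues with negative real parts. Let $(G_1,G_2)$ be an $n_y$-copy internal model of $S$, let $z\in\mathbb{R}^{n_z}$ be the internal model state, $\xi=\mathrm{col}(x,z)\in\mathbb{R}^{n_\xi}$, $n_\xi=n_x+n_z$, and $$A_\xi=\begin{bmatrix} A & 0 \\ G_2C & G_1 \end{bmatrix},\quad B_\xi=\begin{bmatrix} B \\ 0 \end{bmatrix},\quad E_\xi=\begin{bmatrix} E \\ G_2F \end{bmatrix}.$$ Let $U_-\in\mathbb{R}^{n_u\times T}$, $\Xi_-,\Xi_+\in\mathbb{R}^{n_\xi\times T}$ be data matrices satisfying $$\Xi_+=A_\xi\Xi_-+B_\xi U_-+E_\xi V+D$$ for some unknown $V\in\mathbb{R}^{n_v\times T}$ and $D\in\mathbb{R}^{n_\xi\times T}$. Assume that $\begin{bmatrix} U_- \\ \Xi_- \end{bmatrix}$ has full row rank and that, for a given matrix $\Delta$, $$(E_\xi V+D)(E_\xi V+D)^\top\preceq\Delta\Delta^\top.$$ Put $$\Psi=\begin{bmatrix}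 \Xi_- \\ U_- \end{bmatrix}\begin{bmatrix} \Xi_- \\ U_- \end{bmatrix}^\top,\quad \Upsilon=-\begin{bmatrix} \Xi_- \\ U_- \end{bmatrix}\Xi_+^\top,\quad \Sigma=\Xi_+\Xi_+^\top-\Delta\Delta^\top .$$ If there exist matrices $P=P^\top\succ0$ in $\mathbb{R}^{n_\xi\times n_\xi}$ and $Y\in\mathbb{R}^{n_u\times n_\xi}$ such that $$\begin{bmatrix} -\Sigma & \Upsilon^\top-\begin{bmatrix} P \\ Y \end{bmatrix}^\top \\ \Upsilon-\begin{bmatrix} P \\ Y \end{bmatrix} & -\Psi \end{bmatrix}\prec0,$$ then the controller $$u=K_xx+K_zz,\qquad \dot z=G_1z+G_2e,$$ with $K_\xi=[K_x\ \ K_z]=YP^{-1}$, stabilizes the augmented system $\dot\xi=A_\xi\xi+B_\xi u+E_\xi v$, i.e. $A_\xi+B_\xi K_\xi$ is Hurwitz. Furthermore, this controller solves the linear output regulation problem: the closed-loop system with $v(t)=0$ for all $t\ge0$ is exponentially stable, and for any initial states $x(0)$, $z(0)$ and $v(0)$ the closed-loop trajectory satisfies $\lim_{t\to\infty}e(t)=0$.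
   Context: $\mathrm{col}(\cdot)$ denotes stacking of column vectors. The exosignal $v=\mathrm{col}(r,w)$ collects the reference $r\in\mathbb{R}^{n_r}$, $\dot r=S_rr$, and the disturbance $w\in\mathbb{R}^{n_w}$, $\dot w=S_ww$; $n_v=n_r+n_w$, and $n_r=n_y$. Internal model: given a square matrix $S$, a pair $(G_1,G_2)$ is an $n_y$-copy internal model of $S$ if $G_1=\mathrm{blockdiag}(\beta,\dots,\beta)$ and $G_2=\mathrm{blockdiag}(\sigma,\dots,\sigma)$ ($n_y$ blocks each), where $\beta$ is a constant square matrix whose characteristic polynomial equals the minimal polynomial of $S$ and $\sigma$ is a constant column vector such that $(\beta,\sigma)$ is controllable. A real square matrix is Hurwitz if all its eigenvalues have negative real part. $M\prec 0$ ($M\preceq0$) means $M$ is symmetric negative (semi-)definite. The columns of $U_-,\Xi_-,\Xi_+$ are samples of the input, of the state $\xi$ and of its (noisy) derivative; the columns of $V$ are the values of $v$ and those of $D$ the unknown measurement/derivative noise during data collection. *)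

(* Defs.v *)
From HB Require Import structures.
From mathcomp Require Import all_boot all_order all_algebra.
From mathcomp Require Import complex.
From mathcomp Require Import all_classical all_reals all_analysis.

Set Implicit Arguments.
Unset Strict Implicit.
Unset Printing Implicit Defensive.

Import Order.TTheory GRing.Theory Num.Theory.
Import numFieldNormedType.Exports.

Local Open Scope classical_set_scope.
Local Open Scope ring_scope.

Definition complex_eigenvalue (R : realType) n (M : 'M[R]_n) (l : R[i]) : bool :=
  eigenvalue (map_mx (real_complex R) M) l.

Definition hurwitz (R : realType) n (M : 'M[R]_n) : Prop :=
  forall l : R[i], complex_eigenvalue M l -> complex.Re l < 0.

Definition posdef (R : realType) n (M : 'M[R]_n) : Prop :=
  M^T = M /\ forall x : 'cV[R]_n, x != 0 -> 0 < (x^T *m M *m x) 0 0.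

Definition negdef (R : realType) n (M : 'M[R]_n) : Prop :=
  M^T = M /\ forall x : 'cV[R]_n, x != 0 -> (x^T *m M *m x) 0 0 < 0.

Definition negsemidef (R : realType) n (M : 'M[R]_n) : Prop :=
  M^T = M /\ forall x : 'cV[R]_n, (x^T *m M *m x) 0 0 <= 0.

(* mxminpoly is only defined for sizes n.+1; the empty matrix has minimal
   polynomial 1. *)
Definition minpoly (R : realType) n : 'M[R]_n -> {poly R} :=
  match n with
  | 0 => fun=> 1
  | _.+1 => fun M => mxminpoly M
  end.

(* Kalman rank condition: rank [B, AB, ..., A^(n-1) B] = n. *)
Definition controllable (R : realType) n m (A : 'M[R]_n) (B : 'M[R]_(n, m)) : Prop :=
  row_free (\mxrow_(k < n) (A ^+ k *m B)).

(* The i-th block row of G2 is sigma placed in column i, so that the mxcol is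
   blockdiag(sigma, ..., sigma).  The indexed family keeps the internal model
   dimension nz = ny * nb definitionally equal to the index of the block
   matrices, avoiding casts. *)
Inductive internal_model (R : realType) (ny nv : nat) (S : 'M[R]_nv) :
    forall nz : nat, 'M[R]_nz -> 'M[R]_(nz, ny) -> Prop :=
| InternalModel (nb : nat) (beta : 'M[R]_nb) (sigma : 'cV[R]_nb) :
    char_poly beta = minpoly S ->
    controllable beta sigma ->
    internal_model S
      (\mxdiag_(i < ny) beta)
      (\mxcol_(i < ny) (sigma *m delta_mx 0 i)).

(* x is a solution on [0, +oo[ of x'(t) = f(t): the equation is required for
   t > 0 and x is continuous up to t = 0, where it takes its initial value. *)
Definition solves_ode (R : realType) n (x f : R -> 'cV[R]_n) : Prop :=
  {within `[0, +oo[, continuous x} /\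
  forall t : R, 0 < t -> is_derive t 1 x (f t).

Section OutputRegulation.
Variables (R : realType) (nx nu nv ny nz : nat).
Variables (A : 'M[R]_nx) (B : 'M[R]_(nx, nu)) (E : 'M[R]_(nx, nv)).
Variables (S : 'M[R]_nv) (C : 'M[R]_(ny, nx)) (F : 'M[R]_(ny, nv)).
Variables (G1 : 'M[R]_nz) (G2 : 'M[R]_(nz, ny)).
Variables (Kx : 'M[R]_(nu, nx)) (Kz : 'M[R]_(nu, nz)).

Definition closed_loop (x : R -> 'cV[R]_nx) (z : R -> 'cV[R]_nz)
    (v : R -> 'cV[R]_nv) (u : R -> 'cV[R]_nu) (e : R -> 'cV[R]_ny) : Prop :=
  [/\ solves_ode x (fun t => A *m x t + B *m u t + E *m v t),
      solves_ode v (fun t => S *m v t),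
      solves_ode z (fun t => G1 *m z t + G2 *m e t),
      forall t, 0 <= t -> e t = C *m x t + F *m v t &
      forall t, 0 <= t -> u t = Kx *m x t + Kz *m z t].

Definition unforced_exp_stable : Prop :=
  exists M alpha : R, [/\ 0 < M, 0 < alpha &
    forall x z v u e, closed_loop x z v u e ->
      (forall t, 0 <= t -> v t = 0) ->
      forall t, 0 <= t ->
        `|col_mx (x t) (z t)|
          <= M * expR (- alpha * t) * `|col_mx (x 0) (z 0)|].

Definition solves_output_regulation : Prop :=
  unforced_exp_stable /\
  forall x z v u e, closed_loop x z v u e -> e t @[t --> +oo] --> (0 : 'cV[R]_ny).

End OutputRegulation.

(* Main.v *)
Require Import Defs.
From HB Require Import structures.
From mathcomp Require Import all_boot all_order all_algebra.
From mathcomp Require Import complex ring lra.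
From mathcomp Require Import all_classical all_reals all_analysis.

Set Implicit Arguments.
Unset Strict Implicit.
Unset Printing Implicit Defensive.

Import Order.TTheory GRing.Theory Num.Theory.
Import numFieldNormedType.Exports.

Local Open Scope classical_set_scope.
Local Open Scope ring_scope.

(* Testing the LMI on [col(x, - [A B]^T x)] cancels the unknown system matrices
   against the data and leaves [x^T (A + B K) P x < 0], whence the Hurwitz
   property; [P^-1] is then a Lyapunov function, decaying exponentially along
   the unforced closed loop.  The spectra of [S] and [A + B K] being disjoint, the
   Sylvester equation [X S = (A + B K) X + E] has a solution, and [xi - X v]
   follows the unforced closed loop.  The [z]-rows of this equation read
   [Xz S = G1 Xz + G2 (C Xx + F)]: evaluating the minimal polynomial of [S] on
   both sides turns each block into a vanishing combination of the columns
   [sigma, beta sigma, beta^2 sigma, ...], so that [C Xx + F = 0] by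
   controllability, and [e = C (x - Xx v)] tends to 0. *)

(** * Quadratic forms of positive definite matrices and their comparison with the norm *)

Section QuadraticForms.
Variables (R : realType) (n : nat).
Implicit Types (M : 'M[R]_n) (x y : 'cV[R]_n).

(** Writing the scalars [x^T M y] as traces makes linearity and invariance under transposition
    available by rewriting. *)
Lemma mx11_trace (M : 'M[R]_1) : M 0 0 = \tr M.
Proof. by rewrite -trace_mx11. Qed.

Lemma trmx_trace_cV m (M : 'M[R]_(n, m)) x (y : 'cV[R]_m) :
  \tr (y^T *m M^T *m x) = \tr (x^T *m M *m y).
Proof. by rewrite -mxtrace_tr !trmx_mul !trmxK mulmxA. Qed.

Lemma posdef_congruence M (U : 'M[R]_n) :
  posdef M -> U \in unitmx -> posdef (U^T *m M *m U).
Proof.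
move=> [Msym Mpos] Uu; split.
  by rewrite !trmx_mul trmxK Msym mulmxA.
move=> x x0; have -> : x^T *m (U^T *m M *m U) *m x = (U *m x)^T *m M *m (U *m x).
  by rewrite trmx_mul !mulmxA.
apply: Mpos; apply: contra_neq x0 => Ux0.
by rewrite -[x](mulKmx Uu) Ux0 mulmx0.
Qed.

Lemma posdef_unitmx M : posdef M -> M \in unitmx.
Proof.
move=> [_ Mpos]; rewrite -row_free_unit; apply/inj_row_free => v vM0.
apply/eqP; rewrite -trmx_eq0; apply/negPn/negP => /Mpos.
by rewrite trmxK vM0 mul0mx mxE ltxx.
Qed.

(** By symmetry, [M^-1] is the congruence of [M] by [M^-1] itself. *)
Lemma posdef_invmx M : posdef M -> posdef (invmx M).
Proof.
move=> Mp; have Mu := posdef_unitmx Mp.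
have := posdef_congruence Mp (U := invmx M).
by rewrite unitmx_inv trmx_inv Mp.1 mulVmx // mul1mx; apply.
Qed.

(* Expanding [0 <= (x - s y)^T M (x - s y)] at [y = M^-1 e_i] and [s = x_i / y_i]. *)
Lemma posdef_coord_le M x (i : 'I_n) :
  posdef M -> x i 0 ^+ 2 <= invmx M i i * (x^T *m M *m x) 0 0.
Proof.
move=> Mp; have Mu := posdef_unitmx Mp.
have [Msym Mpos] := Mp; have [_ Ipos] := posdef_invmx Mp.
pose e : 'cV[R]_n := delta_mx i 0.
have e0 : e != 0.
  apply/eqP => /matrixP/(_ i 0); rewrite !mxE !eqxx /= => /eqP.
  by rewrite oner_eq0.
have entry (y : 'cV[R]_n) : \tr (e^T *m y) = y i 0.
  by rewrite trmx_delta -rowE trace_mx11 mxE.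
have cpos : 0 < invmx M i i.
  have := Ipos _ e0; rewrite -mulmxA mx11_trace entry.
  by rewrite -colE mxE.
pose s := x i 0 / invmx M i i.
have qf_ge0 (z : 'cV[R]_n) : 0 <= \tr (z^T *m M *m z).
  have [->|z0] := eqVneq z 0; first by rewrite mulmx0 mxtrace0.
  by rewrite -mx11_trace ltW // Mpos.
have := qf_ge0 (x - s *: (invmx M *m e)).
rewrite [(x - _)^T]raddfB /= [(s *: _)^T]linearZ /= !mulmxBl !mulmxBr.
rewrite trmx_mul trmx_inv Msym.
rewrite -!scalemxAl -!scalemxAr !raddfB /= !linearZ /=.
rewrite !mulmxA !mulmxKV // mulmxK // -!mulmxA !entry.
rewrite -(mxtrace_tr (x^T *m e)) trmx_mul trmxK entry -colE [col _ _ _ _]mxE.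
rewrite !mulmxA mx11_trace /GRing.scale /= => h.
rewrite -ler_pdivrMl // mulrC; apply: le_trans (_ : s * x i 0 <= _).
  by rewrite /s expr2 mulrAC.
(* By this choice of [s], the quadratic term in [s] cancels one of the two cross terms [s x_i]. *)
have sc : s * (invmx M) i i = x i 0 by rewrite /s divfK // gt_eqF.
rewrite !mulrN opprK sc in h; lra.
Qed.

(** The norm is the maximum norm, so the bound on each coordinate suffices: [c] dominates every
    diagonal entry of [M^-1], and its summand 1 keeps it positive when [n = 0]. *)
Lemma posdef_norm_le M : posdef M ->
  exists2 c : R, 0 < c & forall x, `|x| ^+ 2 <= c * (x^T *m M *m x) 0 0.
Proof.
move=> Mp; pose c := 1 + \sum_i `|invmx M i i|; exists c => [|x].
  by rewrite ltr_pwDl // sumr_ge0.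
have q0 : 0 <= (x^T *m M *m x) 0 0.
  have [->|x0] := eqVneq x 0; first by rewrite mulmx0 mxE.
  by rewrite ltW // Mp.2.
have c0 : 0 <= c * (x^T *m M *m x) 0 0.
  by rewrite mulr_ge0 // addr_ge0 // sumr_ge0.
rewrite -[leRHS]sqr_sqrtr // lerXn2r ?nnegrE ?sqrtr_ge0 //.
rewrite /Num.Def.normr /= mx_normrE bigmax_le ?sqrtr_ge0 // => -[i j] _ /=.
rewrite ord1 -sqrtr_sqr ler_wsqrtr //.
apply: le_trans (posdef_coord_le x i Mp) _; rewrite ler_wpM2r //.
rewrite /c (bigD1 i) //= (le_trans (ler_norm _)) // addrCA lerDl.
by rewrite addr_ge0 // sumr_ge0.
Qed.

Lemma quadratic_form_le M :
  exists2 c : R, 0 < c & forall x, (x^T *m M *m x) 0 0 <= c * `|x| ^+ 2.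
Proof.
have xle (x : 'cV[R]_n) i : `|x i 0| <= `|x|.
  rewrite [leRHS]/Num.Def.normr /= mx_normrE.
  exact: (le_bigmax _ (fun ij => `|x ij.1 ij.2|) (i, 0)).
exists (1 + \sum_j \sum_i `|M i j|) => [|x].
  by rewrite ltr_pwDl // sumr_ge0 // => j _; rewrite sumr_ge0.
rewrite mxE mulrDl mul1r mulr_suml -[leLHS]add0r lerD ?sqr_ge0 //.
apply: ler_sum => j _; rewrite mxE !mulr_suml; apply: ler_sum => i _.
rewrite mxE (le_trans (ler_norm _)) // !normrM mulrAC mulrC ler_wpM2l //.
by rewrite expr2 ler_pM.
Qed.

End QuadraticForms.

(* Test the LMI on the vector [col(x, - [A B]^T x)]: the form becomes
   [2 x^T (A + B K) P x - |W^T x|^2 + |Delta^T x|^2]. *)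
Lemma lmi_lyapunov (R : realType) (n m T q : nat)
    (A : 'M[R]_n) (B : 'M[R]_(n, m)) (Um : 'M[R]_(m, T)) (Xim Xip W : 'M[R]_(n, T))
    (Delta : 'M[R]_(n, q)) (P : 'M[R]_n) (Y : 'M[R]_(m, n)) :
  let Z := col_mx Xim Um in
  let Upsilon := - (Z *m Xip^T) in
  let Sigma := Xip *m Xip^T - Delta *m Delta^T in
  Xip = A *m Xim + B *m Um + W ->
  negsemidef (W *m W^T - Delta *m Delta^T) ->
  posdef P ->
  negdef (block_mx (- Sigma) (Upsilon^T - (col_mx P Y)^T)
                   (Upsilon - col_mx P Y) (- (Z *m Z^T))) ->
  forall x : 'cV[R]_n, x != 0 ->
    (x^T *m ((A + B *m (Y *m invmx P)) *m P) *m x) 0 0 < 0.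
Proof.
move=> Z Upsilon Sigma Xip_eq [_ Wneg] Ppos [_ lmi] x x0.
pose th := col_mx A^T B^T.
have Xip_th : Xip = th^T *m Z + W.
  by rewrite Xip_eq tr_col_mx !trmxK mul_row_col.
have -> : (A + B *m (Y *m invmx P)) *m P = th^T *m col_mx P Y.
  rewrite tr_col_mx !trmxK mul_row_col mulmxDl -!mulmxA.
  by rewrite mulVmx ?mulmx1 // posdef_unitmx.
have y0 : col_mx x (- (th *m x)) != 0.
  by rewrite col_mx_eq0 (negPf x0).
have := lmi _ y0; have := Wneg x.
rewrite tr_col_mx mul_row_block mul_row_col !mx11_trace.
rewrite /Sigma /Upsilon Xip_th; move: Z {Upsilon Sigma Xip_eq Xip_th lmi y0} => Z.
move: th (col_mx P Y) => th PY.
rewrite !(raddfN, raddfD, mulmxDl, mulmxDr, mulmxN, mulNmx, trmxK, trmx_mul) /=.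
rewrite !(raddfN, raddfD, mulmxDl, mulmxDr, mulmxN, mulNmx, opprK, mulmxA, trmxK, trmx_mul) /=.
(* A scalar equals its transpose, which identifies the mirrored cross terms; what remains is linear
   arithmetic on traces. *)
have e1 : \tr (x^T *m PY^T *m th *m x) = \tr (x^T *m th^T *m PY *m x).
  by rewrite -mxtrace_tr !trmx_mul !trmxK !mulmxA.
have e2 : \tr (x^T *m W *m Z^T *m th *m x) = \tr (x^T *m th^T *m Z *m W^T *m x).
  by rewrite -mxtrace_tr !trmx_mul !trmxK !mulmxA.
rewrite e1 e2; lra.
Qed.

(** * Lyapunov's criterion and complex spectra *)

Section Hurwitz.
Variables (R : realType).

Lemma ReM (x y : R[i]) :
  complex.Re (x * y) = complex.Re x * complex.Re y - complex.Im x * complex.Im y.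
Proof. by case: x y => ? ? [? ?]. Qed.

Lemma ImM (x y : R[i]) :
  complex.Im (x * y) = complex.Re x * complex.Im y + complex.Im x * complex.Re y.
Proof. by case: x y => ? ? [? ?]. Qed.

Lemma Re_sum I (r : seq I) (F : I -> R[i]) :
  complex.Re (\sum_(i <- r) F i) = \sum_(i <- r) complex.Re (F i).
Proof. by apply: (big_morph (@complex.Re R)) => // -[? ?] [? ?]. Qed.

Lemma Im_sum I (r : seq I) (F : I -> R[i]) :
  complex.Im (\sum_(i <- r) F i) = \sum_(i <- r) complex.Im (F i).
Proof. by apply: (big_morph (@complex.Im R)) => // -[? ?] [? ?]. Qed.

(* The real and imaginary parts [a], [b] of a left eigenvector satisfy
   [a A P a^T + b A P b^T = Re l (a P a^T + b P b^T)]. *)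
Lemma lyapunov_hurwitz n (A P : 'M[R]_n) :
  posdef P ->
  (forall x : 'cV[R]_n, x != 0 -> (x^T *m (A *m P) *m x) 0 0 < 0) ->
  hurwitz A.
Proof.
move=> [Psym Ppos] lyap l /eigenvalueP[v vA v0].
pose a : 'cV[R]_n := (map_mx (@complex.Re R) v)^T.
pose b : 'cV[R]_n := (map_mx (@complex.Im R) v)^T.
have aA : a^T *m A = complex.Re l *: a^T - complex.Im l *: b^T.
  apply/rowP => j.
  have /(congr1 (@complex.Re R)) := congr1 (fun w : 'rV[R[i]]_n => w 0 j) vA.
  rewrite !mxE Re_sum ReM => <-; apply: eq_bigr => k _.
  by rewrite !mxE ReM /= mulr0 subr0.
have bA : b^T *m A = complex.Re l *: b^T + complex.Im l *: a^T.
  apply/rowP => j.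
  have /(congr1 (@complex.Im R)) := congr1 (fun w : 'rV[R[i]]_n => w 0 j) vA.
  rewrite !mxE Im_sum ImM => <-; apply: eq_bigr => k _.
  by rewrite !mxE ImM /= mulr0 add0r.
have ab0 : (a != 0) || (b != 0).
  rewrite -negb_and; apply: contra_neqN v0 => /andP[/eqP a0 /eqP b0].
  apply/rowP => j; rewrite mxE; apply/eqP; rewrite eq_complex.
  move/matrixP/(_ j 0): a0; move/matrixP/(_ j 0): b0; rewrite !mxE => -> ->.
  by rewrite eqxx.
have le0 (x : 'cV[R]_n) : (x^T *m (A *m P) *m x) 0 0 <= 0.
  have [->|x0] := eqVneq x 0; first by rewrite mulmx0 mxE.
  by rewrite ltW // lyap.
have ge0 (x : 'cV[R]_n) : 0 <= (x^T *m P *m x) 0 0.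
  have [->|x0] := eqVneq x 0; first by rewrite mulmx0 mxE.
  by rewrite ltW // Ppos.
have sumlt : (a^T *m (A *m P) *m a) 0 0 + (b^T *m (A *m P) *m b) 0 0 < 0.
  case/orP: ab0 => /lyap h; first by rewrite ltr_wnDr.
  by rewrite ltr_wnDl.
(* The two terms in [Im l] cancel because [P] is symmetric. *)
have eqsum : (a^T *m (A *m P) *m a) 0 0 + (b^T *m (A *m P) *m b) 0 0 =
    complex.Re l * ((a^T *m P *m a) 0 0 + (b^T *m P *m b) 0 0).
  rewrite !mulmxA aA bA !mulmxDl !mulNmx -!scalemxAl !mx11_trace.
  rewrite !raddfD !raddfN /= !linearZ /=.
  have -> : \tr (b^T *m P *m a) = \tr (a^T *m P *m b).
    by rewrite -trmx_trace_cV Psym.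
  rewrite /GRing.scale /=; ring.
rewrite ltNge; apply/negP => l0.
by move: sumlt; rewrite eqsum ltNge mulr_ge0 // addr_ge0.
Qed.

(** Coprimality may be tested over the complex numbers, where a common factor would give a common
    eigenvalue, with real part both negative and nonnegative. *)
Lemma coprime_char_poly m n (S : 'M[R]_m) (A : 'M[R]_n) :
  (forall l : R[i], complex_eigenvalue S l -> ~ (complex.Re l < 0)) ->
  hurwitz A -> coprimep (char_poly S) (char_poly A).
Proof.
move=> hS hA; rewrite -(coprimep_map (real_complex R)) !map_char_poly.
apply/Pdiv.ClosedField.coprimepP => l.
rewrite -eigenvalue_root_char => /hS nlt; apply/negP => rA.
by apply/nlt/hA; rewrite /complex_eigenvalue eigenvalue_root_char.
Qed.

End Hurwitz.

(** * Sylvester equations and the internal model principle *)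

Section InternalModel.
Variable F : fieldType.

Lemma horner_mx_intertwine m n (S : 'M[F]_m.+1) (A : 'M[F]_n.+1)
    (X : 'M[F]_(n.+1, m.+1)) (p : {poly F}) :
  X *m S = A *m X -> X *m horner_mx S p = horner_mx A p *m X.
Proof.
move=> XS; elim/poly_ind: p => [|p c IH].
  by rewrite !rmorph0 mulmx0 mul0mx.
rewrite !rmorphD !rmorphM /= !horner_mx_X !horner_mx_C.
rewrite mulmxDr mulmxDl scalar_mxC; congr (_ + _).
by rewrite -!mulmxE mulmxA IH -!mulmxA XS.
Qed.

(** The map [X -> X S - A X] is an endomorphism of a finite-dimensional space, so injectivity is
    enough. Let [p] and [q] be the characteristic polynomials of [S] and [A], with [u p + v q = 1].
    If [X S = A X], evaluating at [A] gives [X = u(A) p(A) X = u(A) X p(S) = 0] by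
    Cayley-Hamilton. *)
Lemma sylvester_solvable m n (S : 'M[F]_m) (A : 'M[F]_n) (E : 'M[F]_(n, m)) :
  coprimep (char_poly S) (char_poly A) ->
  exists X : 'M[F]_(n, m), X *m S = A *m X + E.
Proof.
case: n A E => [|n] A E; first by exists 0; apply/matrixP => -[].
case: m S E => [|m] S E; first by exists 0; apply/matrixP => ? [].
move=> /Bezout_eq1_coprimepP[[u v] /= uv].
pose f : 'M[F]_(n.+1, m.+1) -> 'M[F]_(n.+1, m.+1) := mulmxr S \- mulmx A.
have f_inj : lker (linfun f) == 0%VS.
  rewrite -subv0; apply/subvP => X; rewrite memv_ker lfunE /= => /eqP /subr0_eq XS.
  rewrite memv0 -[X]mul1mx -[1%:M](rmorph1 (horner_mx A)) -uv rmorphD !rmorphM /=.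
  rewrite Cayley_Hamilton mulr0 addr0 -mulmxE -mulmxA.
  by rewrite -(horner_mx_intertwine _ XS) Cayley_Hamilton mulmx0 mulmx0.
exists ((linfun f)^-1%VF E).
have := lker0_lfunVK f_inj E; rewrite lfunE /= => /eqP.
by rewrite subr_eq addrC => /eqP.
Qed.

Lemma horner_mx_sum n (A : 'M[F]_n.+1) (p : {poly F}) N : (size p <= N)%N ->
  horner_mx A p = \sum_(i < N) p`_i *: A ^+ i.
Proof.
move=> pN; rewrite -[p in LHS]coefK poly_def rmorph_sum /=.
rewrite (big_ord_widen N (fun i => horner_mx A (p`_i *: 'X^i))) // big_mkcond.
apply: eq_bigr => i _; rewrite -mul_polyC rmorphM rmorphXn /= horner_mx_X.
rewrite horner_mx_C -mulmxE mul_scalar_mx; case: ltnP => // pi.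
by rewrite nth_default // scale0r.
Qed.

(* [h i] is [g] times the value at [S] of the quotient of [p] by ['X^(i+1)]. *)
Lemma horner_mx_inhomogeneous m n (S : 'M[F]_m.+1) (b : 'M[F]_n.+1)
    (s : 'cV[F]_n.+1) (g : 'rV[F]_m.+1) (X : 'M[F]_(n.+1, m.+1)) :
  X *m S = b *m X + s *m g ->
  forall N (p : {poly F}), (size p <= N.+1)%N ->
  exists2 h : nat -> 'rV[F]_m.+1,
    X *m horner_mx S p = horner_mx b p *m X + \sum_(i < N) b ^+ i *m s *m h i
    & forall k, N = k.+1 -> h k = p`_N *: g.
Proof.
move=> XS; elim=> [|N IH] p pN.
  exists (fun=> 0) => //; rewrite big_ord0 addr0 (size1_polyC pN) !horner_mx_C.
  by rewrite scalar_mxC.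
(* [q] is the quotient of [p] by ['X], so that [p(S) = q(S) S + p_0]. *)
pose q := \poly_(i < N.+1) p`_i.+1.
have pE : p = q * 'X + (p`_0)%:P.
  apply/polyP => -[|i]; rewrite coefD coefMX coefC /= ?add0r // addr0 coef_poly.
  by case: ltnP => // Ni; rewrite nth_default // (leq_trans pN).
have [h hq _] := IH q (size_poly _ _).
(* Multiplying the induction hypothesis by [S] on the right produces [h i S] from the old sum and
   [q_i g] from [q(b) s g]. At the new top index [N] only the latter is present, and [q_N] is the
   top coefficient of [p]. *)
exists (fun i => q`_i *: g + (if (i < N)%N then h i *m S else 0)); last first.
  by move=> k [<-]; rewrite ltnn addr0 coef_poly ltnSn.
have hornerE k (Q : 'M[F]_k.+1) :
    horner_mx Q p = horner_mx Q q *m Q + (p`_0)%:M.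
  by rewrite [in LHS]pE rmorphD rmorphM /= horner_mx_X horner_mx_C.
rewrite !hornerE mulmxDr mulmxDl scalar_mxC addrAC; congr (_ + _).
rewrite mulmxA hq mulmxDl -!mulmxA XS mulmxDr -addrA; congr (_ + _).
under [RHS]eq_bigr do rewrite mulmxDr.
rewrite big_split /=; congr (_ + _).
  rewrite (horner_mx_sum _ (size_poly _ _)) mulmx_suml; apply: eq_bigr => i _.
  by rewrite -scalemxAr -scalemxAl mulmxA.
rewrite big_ord_recr /= ltnn mulmx0 addr0 mulmx_suml.
by apply: eq_bigr => i _; rewrite ltn_ord !mulmxA.
Qed.

End InternalModel.

(** With a single input the controllability matrix is square, so its full row rank also gives a left
    inverse, which cancels it from the sum. *)
Lemma controllable_coeff0 (R : realType) n m (b : 'M[R]_n) (s : 'cV[R]_n)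
    (h : nat -> 'rV[R]_m) :
  controllable b s -> \sum_(i < n) b ^+ i *m s *m h i = 0 ->
  forall i : 'I_n, h i = 0.
Proof.
move=> ctrl sum0 i.
have full : row_full (\mxrow_(k < n) (b ^+ k *m s)).
  by rewrite /row_full (eqP ctrl) sum_nat_const card_ord muln1.
have /row_fullP[L LM] := full.
have H0 : \mxcol_(k < n) h k = 0.
  by rewrite -[LHS]mul1mx -LM -mulmxA mul_mxrow_mxcol sum0 mulmx0.
by rewrite -[LHS](mxcolK (fun k : 'I_n => h k)) H0 submxcol0.
Qed.

(** The common polynomial vanishes at both [S] and [beta], which leaves a zero combination of the
    [beta^i sigma]. All its coefficients vanish by controllability, and the last one is [g] since
    the polynomial is monic. *)
Lemma internal_model_block0 (R : realType) nv nb (S : 'M[R]_nv)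
    (beta : 'M[R]_nb) (sigma : 'cV[R]_nb) (X : 'M[R]_(nb, nv)) (g : 'rV[R]_nv) :
  char_poly beta = minpoly S -> controllable beta sigma ->
  X *m S = beta *m X + sigma *m g -> g = 0.
Proof.
case: nv S X g => [|nv] S X g; first by move=> *; apply/rowP => -[].
case: nb beta sigma X => [|nb] beta sigma X charE ctrl XS.
  (* An empty [beta] has characteristic polynomial 1, which does not vanish at the nonempty [S]. *)
  have /eqP := mx_root_minpoly S; rewrite -[mxminpoly S]charE.
  by rewrite /char_poly det_mx00 rmorph1 oner_eq0.
have size_char : size (char_poly beta) = nb.+2 by rewrite size_char_poly.
have [] := horner_mx_inhomogeneous XS (N := nb.+1) (p := char_poly beta).
  by rewrite size_char.
move=> h; rewrite [in LHS]charE /minpoly mx_root_minpoly Cayley_Hamilton.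
rewrite mulmx0 mul0mx add0r => /esym /(controllable_coeff0 ctrl) h0 /(_ _ erefl).
rewrite (h0 ord_max) => /esym.
have /monicP := char_poly_monic beta; rewrite lead_coefE size_char => ->.
by rewrite scale1r.
Qed.

(** The equation splits along the copies: the [i]-th block row is driven by row [i] of [G] alone. *)
Lemma internal_model_zero (R : realType) ny nv nz (S : 'M[R]_nv)
    (G1 : 'M[R]_nz) (G2 : 'M[R]_(nz, ny)) (X : 'M[R]_(nz, nv)) (G : 'M[R]_(ny, nv)) :
  internal_model S G1 G2 -> X *m S = G1 *m X + G2 *m G -> G = 0.
Proof.
move=> im; case: im X => nb beta sigma charE ctrl X XS.
apply/row_matrixP => i; rewrite row0.
apply: (internal_model_block0 (X := submxcol X i) charE ctrl).
rewrite submxcol_mul XS -[X in _ *m X](submxcolK X) mul_mxdiag_mxcol mxcol_mul.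
rewrite submxcolD !mxcolK -mulmxA; congr (_ + _ *m _).
by rewrite rowE.
Qed.

(** * Scalar calculus on the closed half-line *)

Section HalflineDerivative.
Variable R : realType.
Implicit Types (f g : R -> R).

(** Scalar counterpart of [solves_ode]: at 0 only one-sided continuity is required. *)
Definition halfline_derive f g :=
  {within `[0, +oo[, continuous f} /\ forall t : R, 0 < t -> is_derive t 1 f (g t).

Lemma halfline_derive_eq f f' g :
  (forall t, 0 < t -> f' t = g t) -> halfline_derive f f' -> halfline_derive f g.
Proof. by move=> fg [fc fd]; split=> // t t0; rewrite -fg //; exact: fd. Qed.

Lemma halfline_derive_cst (c : R) : halfline_derive (fun=> c) (fun=> 0).
Proof.
split=> [|t _]; last exact: is_derive_cst.
by apply: continuous_subspaceT => ?; exact: cvg_cst.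
Qed.

Lemma halfline_deriveD f g f' g' :
  halfline_derive f f' -> halfline_derive g g' ->
  halfline_derive (fun t => f t + g t) (fun t => f' t + g' t).
Proof.
move=> [fc fd] [gc gd]; split=> [t|t t0].
  by apply: continuousD; [exact: fc|exact: gc].
by apply: is_deriveD; [exact: fd|exact: gd].
Qed.

Lemma halfline_deriveM f g f' g' :
  halfline_derive f f' -> halfline_derive g g' ->
  halfline_derive (fun t => f t * g t) (fun t => f' t * g t + f t * g' t).
Proof.
move=> [fc fd] [gc gd]; split=> [t|t t0].
  by apply: continuousM; [exact: fc|exact: gc].
have := is_deriveM (fd _ t0) (gd _ t0).
by rewrite /GRing.scale /= addrC [g t * _]mulrC.
Qed.

Lemma halfline_derive_sum n (f f' : 'I_n -> R -> R) :
  (forall i, halfline_derive (f i) (f' i)) ->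
  halfline_derive (fun t => \sum_i f i t) (fun t => \sum_i f' i t).
Proof.
elim: n f f' => [|n IH] f f' fd.
  rewrite (_ : (fun=> _) = fun=> 0); last by apply/funext => t; rewrite big_ord0.
  apply: halfline_derive_eq (halfline_derive_cst 0) => t _.
  by rewrite big_ord0.
rewrite (_ : (fun=> _) = fun t => \sum_(i < n) f (widen_ord (leqnSn n) i) t + f ord_max t).
  apply: halfline_derive_eq (halfline_deriveD (IH _ _ (fun i => fd _)) (fd ord_max)) => t _.
  by rewrite [RHS]big_ord_recr.
by apply/funext => t; rewrite big_ord_recr.
Qed.

Lemma halfline_derive_expR (k : R) :
  halfline_derive (fun t => expR (k * t)) (fun t => k * expR (k * t)).
Proof.
have d (t : R) : is_derive t 1 (fun s => expR (k * s)) (k * expR (k * t)).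
  have dk : is_derive t 1 (fun s : R => k * s) k.
    have := is_deriveZ (f := id) k (is_derive_id t (1 : R)).
    by rewrite /GRing.scale /= mulr1.
  have := is_derive1_comp (f := expR) (g := fun s => k * s) (is_derive_expR _) dk.
  by rewrite mulrC.
split=> //; apply: continuous_subspaceT => t.
by apply/differentiable_continuous/derivable1_diffP; have [] := d t.
Qed.

(** Monotonicity on [[0, t]] needs the derivative only in the interior, together with continuity up
    to the endpoints. *)
Lemma halfline_derive_le0 f f' : halfline_derive f f' ->
  (forall t, 0 < t -> f' t <= 0) -> forall t, 0 <= t -> f t <= f 0.
Proof.
move=> [fc fd] f'le0 t t0.
apply: (@ler0_derive1_le_cc _ f 0 t); rewrite ?in_itv /= ?lexx ?t0 //.
- by move=> s; rewrite in_itv /= => /andP[s0 _]; have [] := fd s s0.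
- move=> s; rewrite in_itv /= => /andP[s0 _].
  by rewrite derive1E; have [_ ->] := fd s s0; exact: f'le0.
- by apply: continuous_subspaceW fc => s /=; rewrite !in_itv /= => /andP[-> _].
Qed.

(** The product [f t * expR (k * t)] has nonpositive derivative. *)
Lemma gronwall_decay f f' k : halfline_derive f f' ->
  (forall t, 0 < t -> f' t <= - k * f t) ->
  forall t, 0 <= t -> f t <= expR (- k * t) * f 0.
Proof.
move=> fd f'le t t0; rewrite mulNr expRN -ler_pdivrMl ?invr_gt0 ?expR_gt0 // invrK mulrC.
have := halfline_derive_le0 (halfline_deriveM fd (halfline_derive_expR k)) _ t0.
rewrite mulr0 expR0 mulr1; apply=> s s0.
rewrite mulrA -mulrDl mulr_le0_ge0 ?expR_ge0 //.
by have := f'le s s0; lra.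
Qed.

End HalflineDerivative.

(** * Vector differential equations, treated coordinate by coordinate, and exponential decay *)

Definition coord_ode (R : realType) n (x f : R -> 'cV[R]_n) :=
  forall i, halfline_derive (fun t => x t i 0) (fun t => f t i 0).

Section Coordinates.
Variables (R : realType) (n : nat).
Implicit Types (x y f g : R -> 'cV[R]_n).

Lemma solves_ode_coord x f : solves_ode x f -> coord_ode x f.
Proof.
move=> [xc xd] i; split=> [t|t t0].
  apply: (@cvg_comp _ _ _ x (fun u : 'cV[R]_n => u i 0) _ _ _ (xc t)).
  exact: coord_continuous.
have [xdt xdE] := xd t t0; split; first by move/derivable_mxP: xdt; apply.
by have := derive_mx xdt; rewrite xdE => ->; rewrite mxE.
Qed.

Lemma coord_ode_eq x f g :
  (forall t, 0 < t -> f t = g t) -> coord_ode x f -> coord_ode x g.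
Proof. by move=> fg xf i; apply: halfline_derive_eq (xf i) => t /fg ->. Qed.

Lemma coord_odeD x y f g : coord_ode x f -> coord_ode y g ->
  coord_ode (fun t => x t + y t) (fun t => f t + g t).
Proof.
move=> xf yg i; rewrite (_ : (fun=> _) = fun t => x t i 0 + y t i 0).
  by apply: halfline_derive_eq (halfline_deriveD (xf i) (yg i)) => t _; rewrite mxE.
by apply/funext => t; rewrite mxE.
Qed.

Lemma coord_ode_mulmx m (L : 'M[R]_(m, n)) x f : coord_ode x f ->
  coord_ode (fun t => L *m x t) (fun t => L *m f t).
Proof.
move=> xf i; rewrite (_ : (fun=> _) = fun t => \sum_j L i j * x t j 0).
  apply: halfline_derive_eq (halfline_derive_sum (fun j =>
    halfline_deriveM (halfline_derive_cst (L i j)) (xf j))) => t _.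
  by rewrite mxE; apply: eq_bigr => j _; rewrite mul0r add0r.
by apply/funext => t; rewrite mxE.
Qed.

Lemma coord_ode_col_mx m x f (y g : R -> 'cV[R]_m) : coord_ode x f -> coord_ode y g ->
  coord_ode (fun t => col_mx (x t) (y t)) (fun t => col_mx (f t) (g t)).
Proof.
move=> xf yg i; case: (split_ordP i) => k ->.
  rewrite (_ : (fun=> _) = fun t => x t k 0).
    by apply: halfline_derive_eq (xf k) => t _; rewrite col_mxEu.
  by apply/funext => t; rewrite col_mxEu.
rewrite (_ : (fun=> _) = fun t => y t k 0).
  by apply: halfline_derive_eq (yg k) => t _; rewrite col_mxEd.
by apply/funext => t; rewrite col_mxEd.
Qed.

Lemma coord_ode_dot x y f g : coord_ode x f -> coord_ode y g ->
  halfline_derive (fun t => ((x t)^T *m y t) 0 0)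
    (fun t => ((f t)^T *m y t + (x t)^T *m g t) 0 0).
Proof.
move=> xf yg; rewrite (_ : (fun=> _) = fun t => \sum_j x t j 0 * y t j 0).
  apply: halfline_derive_eq (halfline_derive_sum (fun j =>
    halfline_deriveM (xf j) (yg j))) => t _.
  rewrite !mxE -big_split; apply: eq_bigr => j _.
  by rewrite !mxE.
by apply/funext => t; rewrite mxE; apply: eq_bigr => j _; rewrite mxE.
Qed.

(** Along a solution, [V = x^T Q x] has derivative [- x^T N x], and
    [x^T N x >= |x|^2 / c1 >= V / (c1 c2)]. Hence [V] decays at rate [k], and the bounds of [Q] from
    both sides carry the decay over to the norm. *)
Lemma lyapunov_decay (A Q : 'M[R]_n) : posdef Q ->
  (forall x : 'cV[R]_n, x != 0 -> (x^T *m (Q *m A) *m x) 0 0 < 0) ->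
  exists M alpha : R, [/\ 0 < M, 0 < alpha &
    forall x, coord_ode x (fun t => A *m x t) ->
      forall t, 0 <= t -> `|x t| <= M * expR (- alpha * t) * `|x 0|].
Proof.
move=> Qp lyap; pose N := - (Q *m A + (Q *m A)^T).
have NE (y : 'cV[R]_n) : (y^T *m N *m y) 0 0 = - 2 * (y^T *m (Q *m A) *m y) 0 0.
  rewrite /N mulmxN mulNmx mulmxDr mulmxDl !mx11_trace raddfN raddfD /=.
  by rewrite trmx_trace_cV; lra.
have Np : posdef N.
  split; first by rewrite /N raddfN raddfD /= trmxK addrC.
  by move=> y /lyap yneg; rewrite NE; lra.
have [c1 c1p N_ge] := posdef_norm_le Np.
have [c2 c2p Q_le] := quadratic_form_le Q.
have [c3 c3p Q_ge] := posdef_norm_le Qp.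
pose k := (c1 * c2)^-1.
have kp : 0 < k by rewrite invr_gt0 mulr_gt0.
(* These are obtained by taking square roots in [|x t|^2 <= c3 c2 expR (- k t) |x 0|^2]. *)
exists (Num.sqrt (c3 * c2)), (k / 2); split; [by rewrite sqrtr_gt0 mulr_gt0|lra|].
move=> x xA t t0.
have dV := coord_ode_dot xA (coord_ode_mulmx Q xA).
have decay : ((x t)^T *m (Q *m x t)) 0 0 <= expR (- k * t) * ((x 0)^T *m (Q *m x 0)) 0 0.
  apply: (gronwall_decay dV) t0 => s s0.
  have -> : ((A *m x s)^T *m (Q *m x s) + (x s)^T *m (Q *m (A *m x s))) 0 0 =
      - ((x s)^T *m N *m x s) 0 0.
    rewrite NE !mx11_trace raddfD /= trmx_mul !mulmxA.
    have := trmx_trace_cV (Q *m A) (x s) (x s).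
    by rewrite trmx_mul Qp.1 !mulmxA => ->; lra.
  rewrite mulNr lerN2 /k invfM -mulrA ler_pdivrMl //.
  apply: le_trans (N_ge (x s)); rewrite ler_pdivrMl //.
  by rewrite !mulmxA Q_le.
rewrite -(@ler_pXn2r _ 2) ?nnegrE ?mulr_ge0 ?sqrtr_ge0 ?expR_ge0 //.
apply: le_trans (Q_ge (x t)) _; rewrite -!mulmxA.
apply: le_trans (ler_wpM2l (ltW c3p) decay) _.
rewrite !exprMn sqr_sqrtr ?mulr_ge0 ?(ltW c3p) ?(ltW c2p) //.
rewrite -expRM_natl (_ : 2%:R * (- (k / 2) * t) = - k * t); last by field.
rewrite -!mulrA ler_pM2l // mulrCA ler_pM2l ?expR_gt0 // mulmxA.
exact: Q_le.
Qed.

End Coordinates.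

(** For maximum norms, the sum [c] of all [|L i j|] bounds the operator norm of [L]; then [|y t|] is
    squeezed between 0 and a multiple of a decaying exponential. *)
Lemma exp_decay_cvg0 (R : realType) n m (L : 'M[R]_(m, n)) (x : R -> 'cV[R]_n)
    (y : R -> 'cV[R]_m) (M alpha : R) :
  0 < alpha ->
  (forall t, 0 <= t -> `|x t| <= M * expR (- alpha * t)) ->
  (forall t, 0 <= t -> y t = L *m x t) ->
  y t @[t --> +oo] --> (0 : 'cV[R]_m).
Proof.
move=> alpha0 xle yE; pose c := \sum_i \sum_j `|L i j|.
have c0 : 0 <= c by apply: sumr_ge0 => i _; exact: sumr_ge0.
have Lle (u : 'cV[R]_n) : `|L *m u| <= c * `|u|.
  rewrite [leLHS]/Num.Def.normr /= mx_normrE bigmax_le ?mulr_ge0 // => -[i j] _ /=.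
  rewrite mxE (le_trans (ler_norm_sum _ _ _)) // /c (bigD1 i) //= mulrDl.
  rewrite -[leLHS]addr0 lerD ?mulr_ge0 ?sumr_ge0 //; last first.
    by move=> k _; exact: sumr_ge0.
  rewrite mulr_suml; apply: ler_sum => k _; rewrite normrM ler_wpM2l //.
  rewrite [leRHS]/Num.Def.normr /= mx_normrE.
  exact: (le_bigmax _ (fun ij => `|u ij.1 ij.2|) (k, j)).
apply: norm_cvg0.
apply: (@squeeze_cvgr _ _ _ _ (fun=> 0) (fun t => c * (M * expR (- (alpha * t))))).
- near=> t; have t0 : 0 <= t by near: t; exact: nbhs_pinfty_ge.
  rewrite normr_ge0 /= yE // (le_trans (Lle _)) // ler_wpM2l //.
  by rewrite -mulNr xle.
- exact: cvg_cst.
- rewrite -(mulr0 c); apply: cvgMr => //; rewrite -(mulr0 M); apply: cvgMr.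
  apply: (@cvg_comp _ _ _ (fun t => alpha * t) (fun t => expR (- t)) _ (pinfty_nbhs R)).
    by apply: gt0_cvgMry => //; exact: cvg_id.
  exact: cvgr_expR.
Unshelve. all: by end_near. Qed.

(** * Output regulation by the closed loop *)

Section Regulation.
Variables (R : realType) (nx nu nv ny nz : nat).
Variables (A : 'M[R]_nx) (B : 'M[R]_(nx, nu)) (E : 'M[R]_(nx, nv)).
Variables (S : 'M[R]_nv) (C : 'M[R]_(ny, nx)) (F : 'M[R]_(ny, nv)).
Variables (G1 : 'M[R]_nz) (G2 : 'M[R]_(nz, ny)) (K : 'M[R]_(nu, nx + nz)).

Let Acl : 'M[R]_(nx + nz) := block_mx A 0 (G2 *m C) G1 + col_mx B 0 *m K.
Let Exi : 'M[R]_(nx + nz, nv) := col_mx E (G2 *m F).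

Let AclE : Acl = block_mx (A + B *m lsubmx K) (B *m rsubmx K) (G2 *m C) G1.
Proof.
rewrite /Acl -{1}(hsubmxK K) mul_col_row add_block_mx !mul0mx add0r.
by rewrite !addr0.
Qed.

Lemma closed_loop_augmented x z v u e :
  closed_loop A B E S C F G1 G2 (lsubmx K) (rsubmx K) x z v u e ->
  coord_ode (fun t => col_mx (x t) (z t))
    (fun t => Acl *m col_mx (x t) (z t) + Exi *m v t).
Proof.
case=> xd _ zd eE uE.
have := coord_ode_col_mx (solves_ode_coord xd) (solves_ode_coord zd).
apply: coord_ode_eq => t /ltW t0; rewrite AclE uE // eE // mul_block_col mul_col_mx.
rewrite add_col_mx !mulmxDr !mulmxDl !mulmxA; congr col_mx; first by rewrite !addrA.
by rewrite addrA; congr (_ + _); rewrite addrC.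
Qed.

(* With [X S = Acl X + Exi], the error [xi - X v] obeys the unforced closed loop,
   and the internal model forces [C Xx + F = 0], so [e = C (x - Xx v)]. *)
Lemma internal_model_regulation (Q : 'M[R]_(nx + nz)) :
  posdef Q ->
  (forall x : 'cV[R]_(nx + nz), x != 0 -> (x^T *m (Q *m Acl) *m x) 0 0 < 0) ->
  coprimep (char_poly S) (char_poly Acl) ->
  internal_model S G1 G2 ->
  solves_output_regulation A B E S C F G1 G2 (lsubmx K) (rsubmx K).
Proof.
move=> Qp lyap cop im; have [M [alpha [M0 alpha0 decay]]] := lyapunov_decay Qp lyap.
split.
  exists M, alpha; split=> // x z v u e cl v0; apply: decay.
  apply: coord_ode_eq (closed_loop_augmented cl) => t /ltW t0.
  by rewrite v0 // mulmx0 addr0.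
move=> x z v u e cl.
have [X XS] := sylvester_solvable Exi cop.
have XzS : dsubmx X *m S = G1 *m dsubmx X + G2 *m (C *m usubmx X + F).
  have := congr1 dsubmx XS; rewrite -mul_dsub_mx => ->.
  rewrite -{1}(vsubmxK X) AclE mul_block_col /Exi add_col_mx col_mxKd.
  by rewrite mulmxDr !mulmxA addrA; congr (_ + _); rewrite addrC.
have /eqP := internal_model_zero im XzS; rewrite addrC addr_eq0 => /eqP FE.
pose zeta t := col_mx (x t) (z t) + (- X) *m v t.
have [_ vd _ eE _] := cl.
have zd : coord_ode zeta (fun t => Acl *m zeta t).
  have := coord_odeD (closed_loop_augmented cl) (coord_ode_mulmx (- X) (solves_ode_coord vd)).
  apply: coord_ode_eq => t _.
  (* The Sylvester equation turns the remaining forcing [Exi v - X S v] into [- Acl X v]. *)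
  rewrite /zeta mulmxDr -addrA; congr (_ + _).
  rewrite !mulmxA mulNmx XS mulmxN !mulNmx mulmxDl opprD addrCA.
  by rewrite subrr addr0.
apply: (exp_decay_cvg0 (x := zeta) (L := row_mx C 0) (M := M * `|zeta 0|) alpha0) => t t0.
  by rewrite mulrAC; exact: decay.
rewrite eE // /zeta mulmxDr mul_row_col mul0mx addr0 -{1}(vsubmxK X) FE.
by rewrite mulmxA mulmxN mul_row_col mul0mx addr0.
Qed.

End Regulation.

Theorem theorem2 (R : realType) (nx nu ny nw nz T q : nat)
    (A : 'M[R]_nx) (B : 'M[R]_(nx, nu)) (C : 'M[R]_(ny, nx))
    (Ew : 'M[R]_(nx, nw)) (Fw : 'M[R]_(ny, nw))
    (Sr : 'M[R]_ny) (Sw : 'M[R]_nw)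
    (G1 : 'M[R]_nz) (G2 : 'M[R]_(nz, ny))
    (Um : 'M[R]_(nu, T)) (Xim Xip : 'M[R]_(nx + nz, T))
    (V : 'M[R]_(ny + nw, T)) (D : 'M[R]_(nx + nz, T))
    (Delta : 'M[R]_(nx + nz, q))
    (P : 'M[R]_(nx + nz)) (Y : 'M[R]_(nu, nx + nz)) :
  let E : 'M[R]_(nx, ny + nw) := row_mx 0 Ew in
  let F : 'M[R]_(ny, ny + nw) := row_mx (- 1%:M) Fw in
  let S : 'M[R]_(ny + nw) := block_mx Sr 0 0 Sw in
  let Axi : 'M[R]_(nx + nz) := block_mx A 0 (G2 *m C) G1 in
  let Bxi : 'M[R]_(nx + nz, nu) := col_mx B 0 in
  let Exi : 'M[R]_(nx + nz, ny + nw) := col_mx E (G2 *m F) in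
  let Z : 'M[R]_((nx + nz) + nu, T) := col_mx Xim Um in
  let Psi := Z *m Z^T in
  let Upsilon := - (Z *m Xip^T) in
  let Sigma := Xip *m Xip^T - Delta *m Delta^T in
  let W := Exi *m V + D in
  let K := Y *m invmx P in
  (forall l : R[i], complex_eigenvalue S l -> ~ (complex.Re l < 0)) ->
  internal_model S G1 G2 ->
  Xip = Axi *m Xim + Bxi *m Um + Exi *m V + D ->
  row_free (col_mx Um Xim) ->
  negsemidef (W *m W^T - Delta *m Delta^T) ->
  posdef P ->
  negdef (block_mx (- Sigma) (Upsilon^T - (col_mx P Y)^T)
                   (Upsilon - col_mx P Y) (- Psi)) ->
  hurwitz (Axi + Bxi *m K) /\
  solves_output_regulation A B E S C F G1 G2 (lsubmx K) (rsubmx K).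
Proof.
move=> E F S Axi Bxi Exi Z Psi Upsilon Sigma W K S_nonneg im Xip_eq _ Wneg Ppos lmi.
have lyap := lmi_lyapunov (W := W) (etrans Xip_eq (esym (addrA _ _ _))) Wneg Ppos lmi.
have hur := lyapunov_hurwitz Ppos lyap.
split=> //; have Pu := posdef_unitmx Ppos.
have Qpos := posdef_invmx Ppos.
apply: (@internal_model_regulation _ _ _ _ _ _ A B E S C F G1 G2 K _ Qpos _
  (coprime_char_poly S_nonneg hur) im).
(* The substitution of [P^-1 x] for [x] turns the inequality for [Acl P] into the one for
   [P^-1 Acl]. *)
move=> x x0; set Acl := (X in invmx P *m X).
have -> : x^T *m (invmx P *m Acl) *m x =
    (invmx P *m x)^T *m (Acl *m P) *m (invmx P *m x).
  by rewrite trmx_mul Qpos.1 !mulmxA mulmxK.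
apply: lyap; apply: contra_neq x0 => Qx0.
by rewrite -[x](mulKVmx Pu) Qx0 mulmx0.
Qed.
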